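(* Let $P,Q\subset\mathbb{R}^3$ be convex polytopes with $0\in\mathrm{int}(P)$ and $0\in\mathrm{int}(Q)$. Let $P=\mathrm{conv}\{v_1,\dots,v_n\}$ and $Q=\{x\in\mathbb{R}^3: Ax\le 1\}$, where $A$ is a real $m\times 3$ matrix with rows $a_1^T,\dots,a_m^T$. Let $U\in SO(3)$ and $\eta\in\mathbb{R}^3$. Suppose $P$ passes through $Q$ with certificate $(U,\eta,0)$ and there exists $\eta'\in\mathbb{R}^3$ such that for all $1\le k\le n$ and $1\le i\le m$, $$a_i^T(Uv_k+z_k\eta)\le 1,\qquad\text{where } z_k=\eta'^Tv_k.$$ Then $Q^*$ passes through $P^*$ with certificate $(U^T,\eta',0)$.
   Context: A convex polytope in $\mathbb{R}^3$ is the convex hull of finitely many points, with non-empty interior. For $\eta\in\mathbb{R}^3\setminus\{0\}$, $\mathrm{proj}_\eta$ denotes the orthogonal projection of $\mathbb{R}^3$ onto the plane through the origin orthogonal to $\eta$; for $\eta=0$, $\mathrm{proj}_0$ is the identity. For $U\in SO(3)$, $\eta,\delta\in\mathbb{R}^3$, $P$ passes through $Q$ with certificate $(U,\eta,\delta)$ if $\mathrm{proj}_\eta(UP+\delta)\subseteq \mathrm{proj}_\eta(Q)$. For a convex polytope $P$ with $0\in\mathrm{int}(P)$, its polar dual is $P^*=\{x\in\mathbb{R}^3: x^Ty\le 1 \text{ for all } y\in P\}$. In $Ax\le 1$, the right-hand side is the all-ones vector and the inequality is componentwise. *)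

(* Defs.v *)
From mathcomp Require Import all_boot all_order all_algebra.
From mathcomp Require Import all_classical all_reals all_analysis.

Set Implicit Arguments.
Unset Strict Implicit.
Unset Printing Implicit Defensive.

Import Order.TTheory GRing.Theory Num.Theory.
Import numFieldNormedType.Exports.

Local Open Scope classical_set_scope.
Local Open Scope ring_scope.

Definition dotmul (R : realType) (d : nat) (x y : 'cV[R]_d) : R :=
  (x^T *m y) 0 0.

Definition conv_hull (R : realType) (d : nat) (S : set 'cV[R]_d) :
    set 'cV[R]_d :=
  smallest (@convex_set R 'cV[R]_d) S.

Definition convex_polytope (R : realType) (P : set 'cV[R]_3) : Prop :=
  (exists2 S : set 'cV[R]_3, finite_set S & P = conv_hull S) /\ P° !=set0.

Definition SO (R : realType) (d : nat) : set 'M[R]_d :=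
  [set U | U^T *m U = 1%:M /\ \det U = 1].
Arguments SO : clear implicits.

Definition proj (R : realType) (eta x : 'cV[R]_3) : 'cV[R]_3 :=
  if eta == 0 then x
  else x - (dotmul eta x / dotmul eta eta) *: eta.

(* Membership of U in SO(3) is part of being a certificate; projections are
   compared as subsets of R^3. *)
Definition passes_through (R : realType) (P Q : set 'cV[R]_3)
    (U : 'M[R]_3) (eta delta : 'cV[R]_3) : Prop :=
  SO R 3 U /\
  proj eta @` [set U *m x + delta | x in P] `<=` proj eta @` Q.

Definition polar_dual (R : realType) (P : set 'cV[R]_3) : set 'cV[R]_3 :=
  [set x | forall y, P y -> dotmul x y <= 1].

(* Main.v *)
Require Import Defs.
From mathcomp Require Import all_boot all_order all_algebra.
From mathcomp Require Import all_classical all_reals all_analysis.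

Import Order.TTheory GRing.Theory Num.Theory.
Import numFieldNormedType.Exports.

Local Open Scope classical_set_scope.
Local Open Scope ring_scope.

(** Given [y] in the dual of [Q], a point of the dual of [P] with the same
    projection along [eta'] as [U^T y] can be written down explicitly:
    [w = U^T y + <eta, y> eta'].  By bilinearity
    [<w, v_k> = <y, U v_k> + <eta, y> <eta', v_k> = <y, U v_k + z_k eta>],
    so that shifting [U^T y] along [eta'] amounts to shifting [U v_k] along
    [eta].  The hypothesis on [eta'] says that [U v_k + z_k eta] belongs to [Q],
    hence the right-hand side is at most 1; this bound passes from the vertices
    to the whole of [P] because a half-space is convex ([conv_hull_dotmul_le]).
    Finally [w] and [U^T y] differ by a multiple of [eta'], hence have the same
    projection ([proj_addZ]). *)

Lemma dotmulDl (R : realType) (d : nat) (x y z : 'cV[R]_d) :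
  dotmul (x + y) z = dotmul x z + dotmul y z.
Proof. by rewrite /dotmul linearD mulmxDl mxE. Qed.

Lemma dotmulZl (R : realType) (d : nat) (a : R) (x z : 'cV[R]_d) :
  dotmul (a *: x) z = a * dotmul x z.
Proof. by rewrite /dotmul linearZ -scalemxAl mxE. Qed.

Lemma dotmulDr (R : realType) (d : nat) (x y z : 'cV[R]_d) :
  dotmul z (x + y) = dotmul z x + dotmul z y.
Proof. by rewrite /dotmul mulmxDr mxE. Qed.

Lemma dotmulZr (R : realType) (d : nat) (a : R) (x z : 'cV[R]_d) :
  dotmul z (a *: x) = a * dotmul z x.
Proof. by rewrite /dotmul -scalemxAr mxE. Qed.

Lemma dotmulC (R : realType) (d : nat) (x y : 'cV[R]_d) :
  dotmul x y = dotmul y x.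
Proof.
by rewrite /dotmul !mxE; apply: eq_bigr => i _; rewrite !mxE mulrC.
Qed.

Lemma dotmul_trmx (R : realType) (d : nat) (U : 'M[R]_d) (x y : 'cV[R]_d) :
  dotmul (U^T *m x) y = dotmul x (U *m y).
Proof. by rewrite /dotmul trmx_mul trmxK mulmxA. Qed.

Lemma dotmul_row (R : realType) (m d : nat) (A : 'M[R]_(m, d)) (i : 'I_m)
    (x : 'cV[R]_d) :
  dotmul (row i A)^T x = (A *m x) i 0.
Proof. by rewrite /dotmul trmxK -row_mul mxE. Qed.

Lemma dotmul_eq0 (R : realType) (d : nat) (x : 'cV[R]_d) :
  (dotmul x x == 0) = (x == 0).
Proof.
apply/eqP/eqP => [|->]; last by rewrite /dotmul mulmx0 mxE.
rewrite /dotmul mxE => /eqP; rewrite psumr_eq0 => [/allP x0|i _]; last first.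
  by rewrite mxE -expr2 sqr_ge0.
apply/colP => i; have := x0 i (mem_index_enum i).
by rewrite !mxE mulf_eq0 orbb => /eqP.
Qed.

(** A half-space is convex, hence is one of the sets whose intersection is the
    hull.  This lets a dual membership be tested on the vertices alone. *)
Lemma conv_hull_dotmul_le (R : realType) (d : nat) (S : set 'cV[R]_d)
    (w : 'cV[R]_d) (c : R) :
  (forall x, S x -> dotmul w x <= c) ->
  forall x, conv_hull S x -> dotmul w x <= c.
Proof.
move=> wS x /(_ [set x | dotmul w x <= c]); apply; split=> //.
move=> y z l; rewrite !inE /= => wy wz.
have -> : dotmul w (conv l y z) =
    l%:num * dotmul w y + (1 - l%:num) * dotmul w z.
  by rewrite -!dotmulZr -dotmulDr.
have -> : c = l%:num * c + (1 - l%:num) * c by rewrite -mulrDl addrC subrK mul1r.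
by rewrite lerD// ler_wpM2l// subr_ge0.
Qed.

(** The line spanned by [eta] is collapsed by the projection; for [eta = 0], where
    [proj eta] is the identity, that line is reduced to the origin. *)
Lemma proj_addZ (R : realType) (eta x : 'cV[R]_3) (t : R) :
  Defs.proj eta (x + t *: eta) = Defs.proj eta x.
Proof.
rewrite /Defs.proj; have [->|eta0] := eqVneq eta 0; first by rewrite scaler0 addr0.
rewrite dotmulDr dotmulZr mulrDl mulfK ?dotmul_eq0//.
by rewrite scalerDl opprD addrACA subrr addr0.
Qed.

Lemma SO_trmx (R : realType) (d : nat) (U : 'M[R]_d) : SO R d U -> SO R d U^T.
Proof. by move=> [UU detU]; split; rewrite ?det_tr// trmxK; exact: mulmx1C. Qed.

Theorem theorem10 (R : realType) (P Q : set 'cV[R]_3)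
  (hP : convex_polytope P) (hQ : convex_polytope Q)
  (hP0 : P° 0) (hQ0 : Q° 0)
  (n : nat) (v : 'I_n -> 'cV[R]_3) (hPv : P = conv_hull (range v))
  (m : nat) (A : 'M[R]_(m, 3))
  (hQA : Q = [set x : 'cV[R]_3 | forall i : 'I_m, (A *m x) i 0 <= 1])
  (U : 'M[R]_3) (hU : SO R 3 U) (eta : 'cV[R]_3)
  (hpass : passes_through P Q U eta 0)
  (eta' : 'cV[R]_3)
  (heta' : forall (k : 'I_n) (i : 'I_m),
     dotmul (row i A)^T (U *m v k + dotmul eta' (v k) *: eta) <= 1) :
  passes_through (polar_dual Q) (polar_dual P) U^T eta' 0.
Proof.
split; first exact: SO_trmx.
move=> _ [_ [y Qy <-] <-].
exists (U^T *m y + dotmul eta y *: eta'); last by rewrite addr0 proj_addZ.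
rewrite hPv; apply: conv_hull_dotmul_le => _ [k _ <-].
have -> : dotmul (U^T *m y + dotmul eta y *: eta') (v k) =
          dotmul y (U *m v k + dotmul eta' (v k) *: eta).
  by rewrite dotmulDl dotmulZl dotmul_trmx dotmulDr dotmulZr (dotmulC _ _ eta)
             [X in _ + X]mulrC.
by apply: Qy; rewrite hQA => i /=; rewrite -dotmul_row.
Qed.
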